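(* Let $X$ be a Banach space such that $X^*$ is $w^*$-separable. Consider the following conditions: (1) $(X^*,w^* )$ is countably tight, i.e. for each $A\subset X^*$ and each $a\in\overline{A}^{w^*}$ there is a countable subset $\{a_n\}_{n<\omega}\subset A$ with $a\in\overline{\{a_n : n<\omega\}}^{w^*}$. (2) $X^*$ is dense-separable in the $w^*$-topology. (3) For each $A\subset X^*$ and $f\in\overline{A}^{w^*}$ there is a countable $A_0\subset A$ such that $f\in\overline{\mathrm{conv}}^{w^*}(A_0)$. (4) For each $A\subset X^*$ and $f\in\overline{A}^{w^*}$ there is a countable $A_0\subset A$ such that $f\in\overline{\mathrm{span}}^{w^*}(A_0)$. (5) $X$ has CSP, i.e. for each $A\subset X^*$ with $\overline{\mathrm{span}}^{w^*}(A)=X^*$ there is a countable $A_0\subset A$ with $\overline{\mathrm{span}}^{w^*}(A_0)=X^*$. Then $(1)\Rightarrow(2)\Rightarrow(5)$ and $(1)\Rightarrow(3)\Rightarrow(4)\Rightarrow(5)$.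
   Context: Banach spaces are real; $X^*$ is the dual of $X$ and $w^*$ its weak-star topology. $\overline{A}^{w^*}$, $\overline{\mathrm{conv}}^{w^*}(A)$, $\overline{\mathrm{span}}^{w^*}(A)$ denote the $w^*$-closures of $A$, of its convex hull and of its linear span, respectively. A topological space $T$ is dense-separable if each dense subset of $T$ is separable (in the relative topology). *)

(* Defs.v *)
From HB Require Import structures.
From mathcomp Require Import all_boot all_order all_algebra.
From mathcomp Require Import all_classical all_reals all_analysis.

Set Implicit Arguments.
Unset Strict Implicit.
Unset Printing Implicit Defensive.

Import Order.TTheory GRing.Theory Num.Theory.
Import numFieldNormedType.Exports.

Local Open Scope classical_set_scope.
Local Open Scope ring_scope.

Section Dual.
Context {R : realType} (X : normedModType R).

Definition continuous_linear_functional : {pred X -> R^o} :=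
  fun f => `[< linear f /\ continuous f >].

(* The topology carried by [dual X] is the weak-star topology, not the one
   given by the operator norm. *)
Record dual := Dual {
  dual_fun :> X -> R^o;
  _ : dual_fun \in continuous_linear_functional
}.

HB.instance Definition _ := [isSub for dual_fun].
HB.instance Definition _ := [Choice of dual by <:].

Lemma continuous_linear_functional_submod :
  submod_closed continuous_linear_functional.
Proof.
split=> [|a f g].
  apply/asboolP; split=> [b u v|]; last by move=> x; exact: cvg_cst.
  by rewrite scaler0 addr0.
move=> /asboolP[fl fc] /asboolP[gl gc]; apply/asboolP; split=> [b u v|x].
  rewrite !fctE fl gl !scalerDr !scalerA [b * a]mulrC -!addrA; congr (_ + _).
  by rewrite !addrA; congr (_ + _); rewrite addrC.
have -> : a *: f + g = (fun y => a *: f y + g y) by apply/funext.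
by apply: cvgD; [apply: cvgZr; exact: fc|exact: gc].
Qed.

HB.instance Definition _ := GRing.isSubmodClosed.Build R (X -> R^o)
  continuous_linear_functional continuous_linear_functional_submod.
HB.instance Definition _ := [SubChoice_isSubLmodule of dual by <:].

HB.instance Definition _ := Topological.copy dual
  (initial_topology (dual_fun : dual -> {ptws X -> R^o})).

End Dual.

Section Topology.
Variable T : topologicalType.

Definition separable := exists2 C : set T, countable C & dense C.

Definition countably_tight := forall (A : set T) (a : T), closure A a ->
  exists A0 : set T, [/\ countable A0, A0 `<=` A & closure A0 a].

End Topology.

(* [set_type D] carries the relative topology. *)
Definition dense_separable (T : topologicalType) :=
  forall D : set T, dense D -> separable (set_type D).

Section Hulls.
Context {R : numDomainType} {V : lmodType R}.

Definition convex_hull (A : set V) : set V := smallest (@convex_set R V) A.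

Definition linear_span (A : set V) : set V :=
  smallest (fun S : set V => submod_closed (mem S)) A.

End Hulls.

Section Conditions.
Context {R : realType} (X : normedModType R).

Definition conv_countably_determined :=
  forall (A : set (dual X)) (f : dual X), closure A f ->
  exists A0 : set (dual X),
    [/\ countable A0, A0 `<=` A & closure (convex_hull A0) f].

Definition span_countably_determined :=
  forall (A : set (dual X)) (f : dual X), closure A f ->
  exists A0 : set (dual X),
    [/\ countable A0, A0 `<=` A & closure (linear_span A0) f].

Definition CSP :=
  forall A : set (dual X), closure (linear_span A) = [set: dual X] ->
  exists A0 : set (dual X),
    [/\ countable A0, A0 `<=` A & closure (linear_span A0) = [set: dual X]].

End Conditions.

(* Main.v *)
Require Import Defs.
From mathcomp Require Import all_boot all_order all_algebra.
From mathcomp Require Import all_classical all_reals all_analysis.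

(** The conclusions that dense subsets are separable and that CSP holds rest on
    one countability argument: if each point of a countable set [B] has a
    property that is witnessed by a countable subset of [A] and survives
    enlarging the witness, then the union of the witnesses is a single countable
    subset of [A] that serves all of [B] ([countable_common_witness]).

    Applied to a countable dense set, it turns pointwise conditions (countable
    tightness, [span_countably_determined]) into global ones: if each point of a
    countable dense set lies in the closure, or in the closed span, of a
    countable part of [D], then [D] has a countable subset that is dense, or has
    dense span, in the whole space.  In the first case this subset is also dense
    in [D] for the relative topology ([separable_set_typeP]), whence
    [dense_separable].

    Both [dense_separable] and [span_countably_determined] must be applied to
    [linear_span A] rather than to [A] in order to reach CSP, since it is the
    span that is dense; they then provide a countable subset [B] of
    [linear_span A] with dense span.  To come back to [A], note that each point
    of the span involves finitely many elements of [A], so that [B] lies in the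
    span of a countable part of [A] ([countable_sub_linear_span]).

    The two implications through [conv_countably_determined] come from the
    inclusions of a set in its convex hull and of the convex hull in the linear
    span. *)

Set Implicit Arguments.
Unset Strict Implicit.
Unset Printing Implicit Defensive.

Import Order.TTheory GRing.Theory Num.Theory.
Import numFieldNormedType.Exports.

Local Open Scope classical_set_scope.
Local Open Scope ring_scope.

Lemma countable_common_witness (T U : Type) (A : set T) (B : set U)
    (P : U -> set T -> Prop) :
  (forall b A1 A2, A1 `<=` A2 -> P b A1 -> P b A2) ->
  countable B ->
  (forall b, B b -> exists A0, [/\ countable A0, A0 `<=` A & P b A0]) ->
  exists A0, [/\ countable A0, A0 `<=` A & forall b, B b -> P b A0].
Proof.
move=> Pmono Bcount BP.
have /choice[F FP] : forall b, exists A0, B b ->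
    [/\ countable A0, A0 `<=` A & P b A0].
  move=> b; have [Bb|nBb] := pselect (B b); last by exists set0.
  by case: (BP b Bb) => A0 A0P; exists A0.
exists (\bigcup_(b in B) F b); split.
- by apply: bigcup_countable => // b /FP[].
- by move=> x [b /FP[_ FA _]]; exact: FA.
- by move=> b Bb; have [_ _] := FP b Bb; apply: Pmono; exact: bigcup_sup.
Qed.

Lemma dense_closureT (T : topologicalType) (D : set T) :
  dense D <-> closure D = [set: T].
Proof.
split=> [Dd|DT O [x Ox] oO].
  apply/seteqP; split=> // x _ B.
  rewrite nbhsE => -[U [oU Ux] UB].
  have [y [Uy Dy]] := Dd U (ex_intro _ x Ux) oU.
  by exists y; split=> //; exact: UB.
have : closure D x by rewrite DT.
by rewrite setIC; apply; exact: open_nbhs_nbhs.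
Qed.

Lemma dense_sub_closure (T : topologicalType) (C D : set T) :
  dense C -> C `<=` closure D -> dense D.
Proof.
move=> /dense_closureT CT CD; apply/dense_closureT/seteqP; split=> // x _.
by apply: closed_closure; apply: (closureS CD); rewrite CT.
Qed.

(** Density is transitive: inside a dense subspace [D], the sets that are dense
    for the relative topology are those that are dense in the whole space. *)
Lemma separable_set_typeP (T : topologicalType) (D : set T) : dense D ->
  separable (set_type D) <->
  exists C : set T, [/\ countable C, C `<=` D & dense C].
Proof.
move=> Dd; split=> [[C Cc Cd]|[C [Cc CD Cd]]].
  exists (set_val @` C); split.
  - exact: sub_countable (card_image_le _ _) Cc.
  - by move=> _ [x _ <-]; exact: set_valP.
  - move=> O O0 oO; have [y [Oy Dy]] := Dd O O0 oO.
    have [||z [Oz Cz]] := Cd (set_val @^-1` O).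
    + by exists (SigSub (mem_set Dy)).
    + by exists O.
    + by exists (set_val z); split=> //; exists z.
exists (set_val @^-1` C : set (set_type D)).
  apply: sub_countable Cc; apply: card_ge_preimage => x y _ _; exact: val_inj.
move=> O [x Ox] [U oU UO]; rewrite -UO in Ox *.
have [y [Uy Cy]] := Cd U (ex_intro _ (set_val x) Ox) oU.
by exists (SigSub (mem_set (CD y Cy))).
Qed.

Section LinearSpan.
Context {R : numDomainType} {V : lmodType R}.
Implicit Types A B : set V.

Lemma linear_span_submod A : submod_closed (mem (linear_span A)).
Proof.
split=> [|a u v].
  by rewrite inE => S [[S0 _] _]; rewrite inE in S0.
rewrite !inE => uA vA S SP; have [[_ Slin] _] := SP.
have : a *: u + v \in mem S by apply: Slin; rewrite inE; [exact: uA|exact: vA].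
by rewrite inE.
Qed.

Lemma linear_spanS A B : A `<=` B -> linear_span A `<=` linear_span B.
Proof. by apply: sub_smallest2r; exact: linear_span_submod. Qed.

Lemma linear_span_sub A B :
  A `<=` linear_span B -> linear_span A `<=` linear_span B.
Proof. by apply: smallest_sub; exact: linear_span_submod. Qed.

Lemma convex_hull_sub_linear_span A : convex_hull A `<=` linear_span A.
Proof.
apply: smallest_sub; last exact: sub_gen_smallest.
have [span0 spanlin] := linear_span_submod A.
move=> x y l xA yA.
have := spanlin l%:num _ _ xA (spanlin (1 - l%:num) _ _ yA span0).
by rewrite addr0.
Qed.

(** The vectors lying in the span of some countable part of [A] form a subspace
    containing [A], because a union of two countable sets is countable; this
    replaces an explicit description of the span by linear combinations. *)
Lemma linear_span_countable A v : linear_span A v ->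
  exists A0, [/\ countable A0, A0 `<=` A & linear_span A0 v].
Proof.
move: v; apply: (@smallest_sub _ _ _
  [set v | exists A0, [/\ countable A0, A0 `<=` A & linear_span A0 v]]).
  split=> [|a u v].
    rewrite inE; exists set0; split=> //.
    by have [] := linear_span_submod set0; rewrite inE.
  rewrite !inE => -[A1 [c1 s1 uA1]] [A2 [c2 s2 vA2]].
  exists (A1 `|` A2); split.
  - by rewrite -bigcup2E; apply: bigcup_countable => // -[|[|]].
  - by rewrite subUset.
  - have [_ lin] := linear_span_submod (A1 `|` A2).
    have := lin a u v; rewrite !inE; apply.
      by apply: linear_spanS uA1; exact: subsetUl.
    by apply: linear_spanS vA2; exact: subsetUr.
move=> v Av; exists [set v]; split=> //; first by move=> _ ->.
exact: sub_gen_smallest.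
Qed.

Lemma countable_sub_linear_span A B :
  countable B -> B `<=` linear_span A ->
  exists A0, [/\ countable A0, A0 `<=` A & linear_span B `<=` linear_span A0].
Proof.
move=> Bc BA.
have [|b /BA|A0 [A0c A0A BA0]] :=
    @countable_common_witness _ _ A B (fun b A0 => linear_span A0 b) _ Bc.
- by move=> b A1 A2 /linear_spanS; apply.
- exact: linear_span_countable.
- by exists A0; split=> //; exact: linear_span_sub.
Qed.

End LinearSpan.

Lemma countably_tight_dense_separable (T : topologicalType) :
  separable T -> countably_tight T -> dense_separable T.
Proof.
move=> [C Cc Cd] tightT D Dd; apply/(separable_set_typeP Dd).
have [|c _|A0 [A0c A0D CA0]] :=
    @countable_common_witness _ _ D C (fun c A0 => closure A0 c) _ Cc.
- by move=> b A1 A2 /closureS; apply.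
- by apply: tightT; move/dense_closureT : Dd => ->.
- by exists A0; split=> //; exact: dense_sub_closure CA0.
Qed.

Section Implications.
Context {R : realType} {X : normedModType R}.

(** The density hypothesis of CSP concerns the span, so a countable selection
    based on it yields vectors of the span, which need not be in [A]; replacing
    each of them by countably many elements of [A] that generate it brings the
    selection back into [A]. *)
Lemma CSP_of_countable_sub_span :
  (forall A : set (dual X), dense (linear_span A) ->
    exists B : set (dual X),
      [/\ countable B, B `<=` linear_span A & dense (linear_span B)]) ->
  CSP X.
Proof.
move=> H A /dense_closureT /H[B [Bc BA /dense_closureT BT]].
have [A0 [A0c A0A BA0]] := countable_sub_linear_span Bc BA.
exists A0; split=> //; apply/seteqP; split=> // f _.
by apply: (closureS BA0); rewrite BT.
Qed.

Lemma dense_separable_CSP : dense_separable (dual X) -> CSP X.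
Proof.
move=> ds; apply: CSP_of_countable_sub_span => A Ad.
have [C [Cc CA Cd]] := (separable_set_typeP Ad).1 (ds _ Ad).
exists C; split=> //; apply: dense_sub_closure Cd _.
by apply: subset_trans (@subset_closure _ _); exact: sub_gen_smallest.
Qed.

Lemma countably_tight_conv :
  countably_tight (dual X) -> conv_countably_determined X.
Proof.
move=> tightX A f /tightX[A0 [A0c A0A fA0]]; exists A0; split=> //.
by apply: closureS fA0; exact: sub_gen_smallest.
Qed.

Lemma conv_span_countably_determined :
  conv_countably_determined X -> span_countably_determined X.
Proof.
move=> convX A f /convX[A0 [A0c A0A fA0]]; exists A0; split=> //.
by apply: closureS fA0; exact: convex_hull_sub_linear_span.
Qed.

Lemma span_countably_determined_CSP :
  separable (dual X) -> span_countably_determined X -> CSP X.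
Proof.
move=> [C Cc Cd] spanX; apply: CSP_of_countable_sub_span => A Ad.
have [|c _|B [Bc BA CB]] := @countable_common_witness _ _ (linear_span A) C
    (fun c B => closure (linear_span B) c) _ Cc.
- by move=> f B1 B2 /linear_spanS/closureS; apply.
- by apply: spanX; move/dense_closureT : Ad => ->.
- by exists B; split=> //; exact: dense_sub_closure CB.
Qed.

End Implications.

Theorem proposition3p1 (R : realType) (X : completeNormedModType R)
    (X_sep : separable (dual X)) :
  [/\ countably_tight (dual X) -> dense_separable (dual X),
      dense_separable (dual X) -> CSP X,
      countably_tight (dual X) -> conv_countably_determined X,
      conv_countably_determined X -> span_countably_determined X &
      span_countably_determined X -> CSP X].
Proof.
split.
- exact: countably_tight_dense_separable.
- exact: dense_separable_CSP.
- exact: countably_tight_conv.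
- exact: conv_span_countably_determined.
- exact: span_countably_determined_CSP.
Qed.
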